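(* Let $A_i\in\mathbb{R}^{n_x\times n_x}$, $B_i\in\mathbb{R}^{n_x\times n_u}$, $C_i\in\mathbb{R}^{n_y\times n_x}$. Suppose there are matrices $P_i=P_i^\top\in\mathbb{R}^{n_x\times n_x}$, $\bar K_i\in\mathbb{R}^{n_u\times n_x}$ and a symmetric matrix $\mathcal{X}_i=\begin{bmatrix}\mathcal{X}_i^{11}&\mathcal{X}_i^{12}\\ \mathcal{X}_i^{21}&\mathcal{X}_i^{22}\end{bmatrix}$ (with $\mathcal{X}_i^{11}\in\mathbb{R}^{n_x\times n_x}$, $\mathcal{X}_i^{22}\in\mathbb{R}^{n_y\times n_y}$) such that $P_i>0$, $\mathcal{X}_i^{11}>0$, $\mathcal{X}_i^{22}<0$ and $$\begin{bmatrix}(-\mathcal{X}_i^{22})^{-1}&\mathbf{0}&C_iP_i&\mathbf{0}\\ \star&P_i&A_iP_i+B_i\bar K_i&\mathbf{I}\\ \star&\star&P_i&P_iC_i^\top\mathcal{X}_i^{21}\\ \star&\star&\star&\mathcal{X}_i^{11}\end{bmatrix}\ge 0 .$$ Then, with the local controller gain $K_i=\bar K_iP_i^{-1}$, the closed-loop subsystem $$x_i(t+1)=(A_i+B_iK_i)x_i(t)+\tilde u_i(t),\qquad y_i(t)=C_ix_i(t),\qquad t=0,1,2,\dots,$$ is $\mathcal{X}_i$-dissipative from $\tilde u_i$ to $y_i$.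
   Context: Matrix inequalities are between symmetric matrices ($>0$ positive definite, $\ge 0$ positive semidefinite); $\star$ denotes blocks determined by symmetry. The closed-loop subsystem arises from $x_i(t+1)=A_ix_i(t)+B_iu_i(t)+w_i(t)$, $y_i(t)=C_ix_i(t)$ with $u_i(t)=K_ix_i(t)+\bar u_i(t)$ and $\tilde u_i(t)=B_i\bar u_i(t)+w_i(t)\in\mathbb{R}^{n_x}$. Dissipativity: a discrete-time system $x(t+1)=f(x(t),u(t))$, $y(t)=h(x(t),u(t))$ is $\mathcal{X}$-dissipative from $u$ to $y$, where $\mathcal{X}=\mathcal{X}^\top=[\mathcal{X}^{kl}]_{k,l\in\{1,2\}}$, if there is a storage function $V:\mathbb{R}^{n_x}\to\mathbb{R}$ with $V(0)=0$, $V(x)>0$ for all $x\ne 0$, and $$V(x(t+1))-V(x(t))\le\begin{bmatrix}u(t)\\ y(t)\end{bmatrix}^\top\begin{bmatrix}\mathcal{X}^{11}&\mathcal{X}^{12}\\ \mathcal{X}^{21}&\mathcal{X}^{22}\end{bmatrix}\begin{bmatrix}u(t)\\ y(t)\end{bmatrix}$$ for all $t\in\{0,1,2,\dots\}$, all input sequences and all corresponding trajectories. *)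

(* Defs.v *)
From HB Require Import structures.
From mathcomp Require Import all_boot all_order all_algebra.
From mathcomp Require Import reals.

Set Implicit Arguments.
Unset Strict Implicit.
Unset Printing Implicit Defensive.

Import Order.TTheory GRing.Theory Num.Theory.

Local Open Scope ring_scope.

(* Real quadratic form z^T M z, read off the 1 x 1 matrix. *)
Definition quad_form (R : realType) (n : nat) (M : 'M[R]_n) (z : 'cV[R]_n) : R :=
  (z^T *m M *m z) 0 0.

(* Definiteness is only meaningful for symmetric matrices here, so symmetry
   is part of the predicates. M < 0 is expressed as posdef_mx (- M). *)
Definition posdef_mx (R : realType) (n : nat) (M : 'M[R]_n) : Prop :=
  M^T = M /\ forall z : 'cV[R]_n, z != 0 -> 0 < quad_form M z.

Definition possemidef_mx (R : realType) (n : nat) (M : 'M[R]_n) : Prop :=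
  M^T = M /\ forall z : 'cV[R]_n, 0 <= quad_form M z.

(* 4 x 4 block matrix given by its upper triangle; every strictly lower block
   is the transpose of its mirror image. *)
Definition sym_block4_mx (R : realType) (n1 n2 n3 n4 : nat)
    (M11 : 'M[R]_n1) (M12 : 'M[R]_(n1, n2)) (M13 : 'M[R]_(n1, n3))
    (M14 : 'M[R]_(n1, n4))
    (M22 : 'M[R]_n2) (M23 : 'M[R]_(n2, n3)) (M24 : 'M[R]_(n2, n4))
    (M33 : 'M[R]_n3) (M34 : 'M[R]_(n3, n4))
    (M44 : 'M[R]_n4) : 'M[R]_((n1 + n2) + (n3 + n4)) :=
  block_mx (block_mx M11   M12   M12^T M22)   (block_mx M13   M14   M23   M24)
           (block_mx M13^T M23^T M14^T M24^T) (block_mx M33   M34   M34^T M44).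

(* Dissipativity of x(t+1) = f (x t) (u t), y(t) = h (x t) (u t) from u to y
   with respect to the supply rate given by the symmetric matrix X, whose
   blocks are split according to the stacked vector (u, y). *)
Definition dissipative (R : realType) (n m p : nat)
    (f : 'cV[R]_n -> 'cV[R]_m -> 'cV[R]_n)
    (h : 'cV[R]_n -> 'cV[R]_m -> 'cV[R]_p)
    (X : 'M[R]_(m + p)) : Prop :=
  X^T = X /\
  exists V : 'cV[R]_n -> R,
    [/\ V 0 = 0,
        forall x : 'cV[R]_n, x != 0 -> 0 < V x
      & forall (u : nat -> 'cV[R]_m) (x : nat -> 'cV[R]_n) (y : nat -> 'cV[R]_p),
          (forall t : nat, x t.+1 = f (x t) (u t)) ->
          (forall t : nat, y t = h (x t) (u t)) ->
          forall t : nat,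
            V (x t.+1) - V (x t) <= quad_form X (col_mx (u t) (y t))].

(* Main.v *)
(** The storage function is [V x = x^T P^-1 x]. Writing [x'] for the successor
    state and [y = C x], the quadratic form of the LMI at the stacked vector
    [(X22 y, - P^-1 x', P^-1 x, u)] equals
    [V x - V x' + (u, y)^T X (u, y)], so its nonnegativity is exactly the
    dissipation inequality. *)

Require Import Defs.
From HB Require Import structures.
From mathcomp Require Import all_boot all_order all_algebra.
From mathcomp Require Import reals ring lra.

Set Implicit Arguments.
Unset Strict Implicit.
Unset Printing Implicit Defensive.

Import Order.TTheory GRing.Theory Num.Theory.

Local Open Scope ring_scope.

(** A 1 x 1 matrix equals its transpose; this merges each pair of mirror cross terms into a doubled
    one. *)
Lemma mulmx_tr_form (R : comPzRingType) (m n : nat) (M : 'M[R]_(m, n))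
    (a : 'cV[R]_m) (b : 'cV[R]_n) :
  (b^T *m M^T *m a) 0 0 = (a^T *m M *m b) 0 0.
Proof.
by rewrite -[in RHS](trmxK (a^T *m M *m b)) [RHS]mxE !trmx_mul trmxK mulmxA.
Qed.

Lemma quad_form_mul (R : realType) (m n : nat) (M : 'M[R]_m) (T : 'M[R]_(m, n))
    (z : 'cV[R]_n) :
  quad_form M (T *m z) = quad_form (T^T *m M *m T) z.
Proof. by rewrite /quad_form trmx_mul !mulmxA. Qed.

Lemma quad_formN (R : realType) (n : nat) (M : 'M[R]_n) (z : 'cV[R]_n) :
  quad_form M (- z) = quad_form M z.
Proof. by rewrite /quad_form [(- z)^T]linearN !mulNmx mulmxN opprK. Qed.

Lemma quad_form_block (R : realType) (m n : nat) (M11 : 'M[R]_m)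
    (M12 : 'M[R]_(m, n)) (M22 : 'M[R]_n) (a : 'cV[R]_m) (b : 'cV[R]_n) :
  quad_form (block_mx M11 M12 M12^T M22) (col_mx a b) =
  quad_form M11 a + (a^T *m M12 *m b) 0 0 *+ 2 + quad_form M22 b.
Proof.
rewrite /quad_form tr_col_mx mul_row_block mul_row_col !mulmxDl.
by rewrite ![fun_of_matrix (_ + _) 0 0]mxE mulmx_tr_form mulr2n !addrA.
Qed.

Lemma quad_form_sym_block4 (R : realType) (n1 n2 n3 n4 : nat)
    (M11 : 'M[R]_n1) (M12 : 'M[R]_(n1, n2)) (M13 : 'M[R]_(n1, n3))
    (M14 : 'M[R]_(n1, n4)) (M22 : 'M[R]_n2) (M23 : 'M[R]_(n2, n3))
    (M24 : 'M[R]_(n2, n4)) (M33 : 'M[R]_n3) (M34 : 'M[R]_(n3, n4))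
    (M44 : 'M[R]_n4) (a : 'cV[R]_n1) (b : 'cV[R]_n2) (c : 'cV[R]_n3)
    (d : 'cV[R]_n4) :
  quad_form (sym_block4_mx M11 M12 M13 M14 M22 M23 M24 M33 M34 M44)
            (col_mx (col_mx a b) (col_mx c d)) =
  quad_form M11 a + quad_form M22 b + quad_form M33 c + quad_form M44 d
  + ((a^T *m M12 *m b) 0 0 + (a^T *m M13 *m c) 0 0 + (a^T *m M14 *m d) 0 0
     + (b^T *m M23 *m c) 0 0 + (b^T *m M24 *m d) 0 0
     + (c^T *m M34 *m d) 0 0) *+ 2.
Proof.
(* Folding the lower left block into the transpose of the upper right one exposes a symmetric 2 x 2
   block matrix, so the two-block expansion applies at the outer level and again in both diagonal
   blocks. *)
rewrite /sym_block4_mx -tr_block_mx !quad_form_block.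
rewrite tr_col_mx mul_row_block mul_row_col !mulmxDl.
rewrite ![fun_of_matrix (_ + _) 0 0]mxE.
ring.
Qed.

(** A nonzero row [v] with [v *m M = 0] would make the form vanish at [v^T]. *)
Lemma posdef_mx_unit (R : realType) (n : nat) (M : 'M[R]_n) :
  posdef_mx M -> M \in unitmx.
Proof.
case=> _ M_gt0; rewrite -row_free_unit -kermx_eq0; apply: contraT.
case/rowV0Pn => v /sub_kermxP vM0 v_neq0.
have := M_gt0 v^T; rewrite trmx_eq0 v_neq0 => /(_ isT).
by rewrite /quad_form trmxK vM0 mul0mx mxE ltxx.
Qed.

Lemma quad_form_invmx (R : realType) (n : nat) (M : 'M[R]_n) (z : 'cV[R]_n) :
  posdef_mx M -> quad_form M (invmx M *m z) = quad_form (invmx M) z.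
Proof.
move=> M_gt0; rewrite quad_form_mul trmx_inv M_gt0.1.
by rewrite mulVmx ?mul1mx // posdef_mx_unit.
Qed.

Lemma posdef_mx_inv (R : realType) (n : nat) (M : 'M[R]_n) :
  posdef_mx M -> posdef_mx (invmx M).
Proof.
move=> M_gt0; have M_unit := posdef_mx_unit M_gt0.
split=> [|z z_neq0]; first by rewrite trmx_inv M_gt0.1.
rewrite -quad_form_invmx //; apply: M_gt0.2.
by apply: contraNneq z_neq0 => Mz0; rewrite -[z](mulKVmx M_unit) Mz0 mulmx0.
Qed.

Theorem proposition3 (R : realType) (nx nu ny : nat)
    (A : 'M[R]_nx) (B : 'M[R]_(nx, nu)) (C : 'M[R]_(ny, nx))
    (P : 'M[R]_nx) (Kbar : 'M[R]_(nu, nx))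
    (X11 : 'M[R]_nx) (X12 : 'M[R]_(nx, ny))
    (X21 : 'M[R]_(ny, nx)) (X22 : 'M[R]_ny)
    (P_sym : P^T = P)
    (X_sym : (block_mx X11 X12 X21 X22)^T = block_mx X11 X12 X21 X22)
    (P_gt0 : posdef_mx P)
    (X11_gt0 : posdef_mx X11)
    (X22_lt0 : posdef_mx (- X22))
    (LMI : possemidef_mx
       (sym_block4_mx
          (invmx (- X22)) (0 : 'M[R]_(ny, nx)) (C *m P) (0 : 'M[R]_(ny, nx))
                          P (A *m P + B *m Kbar) (1%:M : 'M[R]_nx)
                                                 P (P *m C^T *m X21)
                                                                 X11)) :
  let K : 'M[R]_(nu, nx) := Kbar *m invmx P in
  dissipative (fun (x : 'cV[R]_nx) (v : 'cV[R]_nx) => (A + B *m K) *m x + v)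
              (fun (x : 'cV[R]_nx) (v : 'cV[R]_nx) => C *m x)
              (block_mx X11 X12 X21 X22).
Proof.
move=> K; split=> //.
have P_unit := posdef_mx_unit P_gt0; have W_unit := posdef_mx_unit X22_lt0.
exists (quad_form (invmx P)); split.
- by rewrite /quad_form mulmx0 mxE.
- exact: (posdef_mx_inv P_gt0).2.
move=> u x y x_next y_out t.
have := X_sym; rewrite tr_block_mx => /eq_block_mx[_ X21T X12T X22T].
(* In the coordinate [z] the gain [Kbar *m invmx P] loses its inverse, so the blocks of the LMI
   produce the closed-loop dynamics directly. *)
set z := invmx P *m x t.
have xE : x t = P *m z by rewrite mulKVmx.
have x_nextE : (A *m P + B *m Kbar) *m z + u t = x t.+1.
  by rewrite x_next xE /K !mulmxDl !mulmxA mulmxKV.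
have yE : C *m P *m z = y t by rewrite y_out xE mulmxA.
(* For fixed [z] and [u t], the first two components are the minimizers of the form, as in a Schur
   complement: they solve [invmx (- X22) *m a + y t = 0] and [P *m b + x t.+1 = 0]. *)
have := LMI.2 (col_mx (col_mx (X22 *m y t) (- (invmx P *m x t.+1)))
                      (col_mx z (u t))).
rewrite quad_form_sym_block4 quad_formN !quad_form_invmx //.
rewrite !mulmx0 !mul0mx ![fun_of_matrix 0 0 0]mxE.
have -> : quad_form (invmx (- X22)) (X22 *m y t) = - quad_form X22 (y t).
  rewrite -[X22 *m y t]opprK -mulNmx quad_formN quad_form_mul X22_lt0.1.
  by rewrite mulmxV // mul1mx /quad_form mulmxN mulNmx mxE.
have -> : ((X22 *m y t)^T *m (C *m P) *m z) 0 0 = quad_form X22 (y t).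
  by rewrite -mulmxA yE trmx_mul X22T.
have -> : (z^T *m (P *m C^T *m X21) *m u t) 0 0 = ((y t)^T *m X21 *m u t) 0 0.
  by rewrite -yE !trmx_mul P_sym !mulmxA.
(* The second block row applied to [z] and [u t] sums to the successor state, so its two cross terms
   are evaluated together. *)
have x_next_cross :
    ((- (invmx P *m x t.+1))^T *m (A *m P + B *m Kbar) *m z) 0 0
    + ((- (invmx P *m x t.+1))^T *m 1%:M *m u t) 0 0
    = - quad_form (invmx P) (x t.+1).
  transitivity (((- (invmx P *m x t.+1))^T *m x t.+1) 0 0).
    (* Generalizing the left factor hides its own [x t.+1], so that only the right one is
       expanded. *)
    move: (- _)^T => w.
    by rewrite -x_nextE -mulmxA [w *m (_ + _)]mulmxDr mulmx1 [RHS]mxE.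
  by rewrite [(- _)^T]linearN /= trmx_mul trmx_inv P_sym mulNmx mxE.
(* Symmetry of the supply matrix identifies its cross term with that of the LMI; the rest is linear
   in the remaining scalars. *)
rewrite -X12T quad_form_block -X21T mulmx_tr_form.
lra.
Qed.
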